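(* Let $r>1$, $j\in\{1,2\}$, $\alpha=(\alpha_1,\alpha_2)\in\mathcal A_1\times\mathcal A_2$ and $\gamma_{3-j}\in\Gamma_{3-j}$. Assume that $u_k(\cdot,\alpha_k)\in L^\infty(\Gamma_{\mathcal M})$ for $k=1,2$ and all $\alpha_k\in\mathcal A_k$, and that $f\in L^\infty_{2r}(\mathbb R^2\times[-L^z,L^z])$. Then $$\int_{\mathbb R^2}\big|f\big(x+g_{j,\alpha,\gamma_{3-j}}(x)\big)\big|\,dx\le\frac{5^{r-1}\pi}{r-1}\,\big(1+d+\|u_1\|_\infty+\|u_2\|_\infty\big)^{2r}\,\|\langle\cdot\rangle^{2r}f\|_{L^\infty(\mathbb R^2\times[-L^z,L^z])}.$$
   Context: Let $q>0$, $\theta\in\mathbb R$, $A\in GL_2(\mathbb R)$, and let $R_\phi$ be rotation of $\mathbb R^2$ by $\phi$. Set $A_1=q^{-1/2}R_{-\theta/2}A$, $A_2=q^{1/2}R_{\theta/2}A$, $\mathcal R_j=A_j\mathbb Z^2$, $\Gamma_j=A_j[0,1)^2$, $\mathcal R_j^*=2\pi A_j^{-T}\mathbb Z^2$. Standing assumptions: $\mathcal R_1^*\cap\mathcal R_2^*=\{0\}$ and $\mathcal R_1\cap\mathcal R_2=\{0\}$. Moiré lattice: $A_{\mathcal M}=(A_1^{-1}-A_2^{-1})^{-1}$, $\mathcal R_{\mathcal M}=A_{\mathcal M}\mathbb Z^2$, $\Gamma_{\mathcal M}=A_{\mathcal M}[0,1)^2$. Put $D_{j\to3-j}=I-A_{3-j}A_j^{-1}$.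 $\mathcal A_1,\mathcal A_2$ are finite sets; each $\alpha_j\in\mathcal A_j$ has a shift vector $\tau_j^{(\alpha_j)}\in\mathbb R^2$. Vectors of $\mathbb R^2$ are identified with vectors of $\mathbb R^3$ having zero third component. The displacements $u_j(\cdot,\alpha_j)$ take values in $\mathbb R^3$ and are extended $\mathcal R_{\mathcal M}$-periodically to $\mathbb R^2$; $\|u_j\|_\infty$ is the $L^\infty$ norm over both $x$ and $\alpha_j$, and $u_{j,z}$ is the third component of $u_j$. Define $$g_{j,\alpha,\gamma_{3-j}}(y)=\tau_j^{(\alpha_j)}-\tau_{3-j}^{(\alpha_{3-j})}+u_j\big(D_{j\to3-j}^{-1}(y+\gamma_{3-j}),\alpha_j\big)-u_{3-j}\big(D_{j\to3-j}^{-1}(y+\gamma_{3-j})-y,\alpha_{3-j}\big),\quad y\in\mathbb R^2,$$ $d=\max_{\alpha_1,\alpha_2}|\tau_1^{(\alpha_1)}-\tau_2^{(\alpha_2)}|$, $L^z=d+\|u_{1,z}\|_\infty+\|u_{2,z}\|_\infty$, $\langle x\rangle=(1+|x|^2)^{1/2}$, and $L^\infty_{2r}(\Omega)=\{f\in L^\infty(\Omega):\|\langle\cdot\rangle^{2r}f\|_{L^\infty(\Omega)}<\infty\}$.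
   Formalization: The norm of f on R^2×[-L^z,L^z] is the supremum over all points, for a Borel f defined everywhere, not an essential supremum: with the latter the claim fails, e.g. u=0, d>0, f the indicator of the plane z=0. *)

(* Defs.v *)
From mathcomp Require Import all_boot all_order all_algebra.
From mathcomp Require Import complex.
From mathcomp Require Import all_classical all_reals all_analysis.

Set Implicit Arguments.
Unset Strict Implicit.
Unset Printing Implicit Defensive.
Import Order.TTheory GRing.Theory Num.Theory.
Import numFieldNormedType.Exports.

Local Open Scope classical_set_scope.
Local Open Scope ring_scope.

(* R^2 and R^3 are iterated products, so that they carry the product
   sigma-algebra and, for R^2, the product measure. *)
Notation R2 R := (R * R)%type.
Notation R3 R := (R * R * R)%type.

Definition lebesgue2 {R : realType} := (@lebesgue_measure R \x @lebesgue_measure R)%E.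

Section Euclidean.
Variable R : realType.
Implicit Types (M : 'M[R]_2) (x : R2 R) (p : R3 R) (D : set (R2 R)).

Definition mx2 (a b c d : R) : 'M[R]_2 :=
  \matrix_(i < 2, j < 2)
    if i == 0 then (if j == 0 then a else b) else (if j == 0 then c else d).

Definition mulv M x : R2 R :=
  (M 0 0 * x.1 + M 0 1 * x.2, M 1 0 * x.1 + M 1 1 * x.2).

Definition rotation (phi : R) : 'M[R]_2 :=
  mx2 (cos phi) (- sin phi) (sin phi) (cos phi).

Definition lattice M : set (R2 R) :=
  [set mulv M (n.1%:~R, n.2%:~R) | n in [set: int * int]].

Definition dual_lattice M : set (R2 R) :=
  lattice (2 * pi *: (invmx M)^T).

Definition cell M : set (R2 R) := mulv M @` (`[0, 1[ `*` `[0, 1[).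

(* the identification of R^2 with R^2 x {0} *)
Definition flat x : R3 R := (x, 0).

(* The library norm on a product is the max norm, hence an explicit Euclidean
   norm. *)
Definition enorm p : R := Num.sqrt (p.1.1 ^+ 2 + p.1.2 ^+ 2 + p.2 ^+ 2).

Definition japanese p : R := Num.sqrt (1 + enorm p ^+ 2).

(* the L^oo(D) norm: [\_] extends by 0 outside D *)
Definition Linfty_norm D (h : R2 R -> R) : \bar R :=
  ('N[lebesgue2]_+oo [EFin \o (h \_ D)])%E.

Definition Linfty D (v : R2 R -> R3 R) : Prop :=
  measurable_fun D v /\ (Linfty_norm D (fun x => enorm (v x)) < +oo)%E.

End Euclidean.

(* Elements of [Linfty_weighted] are composed below with maps from R^2 to R^3,
   whose range is Lebesgue-null in R^3.  An essential supremum over a subset of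
   R^3 does not control such a composition, so the norms of f are suprema over
   all points of the domain and f is Borel measurable. *)
Section Weighted.
Variable R : realType.
Implicit Types (Omega : set (R3 R)) (f : R3 R -> R[i]) (s : R).

Definition cabs (z : R[i]) : R := ComplexField.Normc.normc z.

(* the norm of <.>^s f on Omega *)
Definition weighted_norm s Omega f : \bar R :=
  ereal_sup [set (japanese p `^ s * cabs (f p))%:E | p in Omega].

Definition Linfty_weighted s Omega f : Prop :=
  [/\ measurable_fun Omega (fun p => complex.Re (f p)),
      measurable_fun Omega (fun p => complex.Im (f p)),
      (ereal_sup [set (cabs (f p))%:E | p in Omega] < +oo)%E &
      (weighted_norm s Omega f < +oo)%E].

End Weighted.

Variant layer := L1 | L2.

Definition other (j : layer) : layer := if j is L1 then L2 else L1.

Section Bilayer.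
Variables (R : realType) (q theta : R) (A : 'M[R]_2).

Definition layer_mx (j : layer) : 'M[R]_2 :=
  if j is L1 then q `^ (- 2^-1) *: (rotation (- (theta / 2)) *m A)
  else q `^ 2^-1 *: (rotation (theta / 2) *m A).

(* [invmx] is the identity on singular matrices; invmx A_1 - invmx A_2 is
   invertible as soon as A is invertible, q > 0 and the lattices of the two
   layers meet only at 0. *)
Definition moire_mx : 'M[R]_2 :=
  invmx (invmx (layer_mx L1) - invmx (layer_mx L2)).

Definition disregistry_mx (j : layer) : 'M[R]_2 :=
  1%:M - layer_mx (other j) *m invmx (layer_mx j).

Definition incommensurate : Prop :=
  dual_lattice (layer_mx L1) `&` dual_lattice (layer_mx L2) = [set 0] /\
  lattice (layer_mx L1) `&` lattice (layer_mx L2) = [set 0].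

Variable sites : layer -> finType.
Variables (tau : forall j, sites j -> R2 R) (u : forall j, sites j -> R2 R -> R3 R).

Definition moire_periodic : Prop :=
  forall j (a : sites j) x t, lattice moire_mx t -> u a (x + t) = u a x.

(* norm over both the position and the sublattice index; it is meaningful when
   the individual norms are finite, because [fine] sends +oo to 0 *)
Definition disp_norm (j : layer) : R :=
  \big[Num.max/0]_(a : sites j)
    fine (Linfty_norm (cell moire_mx) (fun x => enorm (u a x))).

Definition dispz_norm (j : layer) : R :=
  \big[Num.max/0]_(a : sites j)
    fine (Linfty_norm (cell moire_mx) (fun x => `|(u a x).2|)).

Definition shift_diam : R :=
  \big[Num.max/0]_(a1 : sites L1) \big[Num.max/0]_(a2 : sites L2)
    enorm (flat (tau a1 - tau a2)).

Definition height : R := shift_diam + dispz_norm L1 + dispz_norm L2.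

Definition slab : set (R3 R) := [set: R2 R] `*` `[- height, height].

Definition interlayer_shift (j : layer) (alpha : forall k, sites k)
    (gamma y : R2 R) : R3 R :=
  let z := mulv (invmx (disregistry_mx j)) (y + gamma) in
  flat (tau (alpha j)) - flat (tau (alpha (other j)))
  + u (alpha j) z - u (alpha (other j)) (z - y).

End Bilayer.

Arguments interlayer_shift {R} q theta A {sites} tau u j alpha gamma y.

(* Main.v *)
Require Import Defs.
From mathcomp Require Import all_boot all_order all_algebra.
From mathcomp Require Import complex.
From mathcomp Require Import ring lra.
From mathcomp Require Import all_classical all_reals all_analysis.
From mathcomp Require Import measurable_realfun ess_sup_inf.
Import Order.TTheory GRing.Theory Num.Theory.
Import numFieldNormedType.Exports.
Local Open Scope classical_set_scope.
Local Open Scope ring_scope.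

(* For almost every x the shift g satisfies |g(x)| <= C, where
   C = d + ||u_1|| + ||u_2||, and x + g(x) lies in the slab: the exceptional
   sets of u_1 and u_2 are null in a unit cell, hence null in the plane by
   periodicity, and both arguments D^-1 (y + gamma) and D^-1 (y + gamma) - y
   are invertible affine functions of y.  Then
   1 + |x|^2 <= (1 + C)^2 (1 + |x + g(x)|^2), so the integrand is at most
   W (1 + C)^(2r) (1 + |x|^2)^(-r), where W is the weighted norm of f.

   The integral of (1 + |x|^2)^(-r) over the plane is at most
   4^(r-1) pi / (r-1), without polar coordinates: with s = 1 + x_1^2,
   (s + x_2^2)^(-r) <= s^(-(r-1)) (s + x_2^2)^(-1) integrates in x_2 to
   pi s^(-(r-1/2)), and the integral in x_1 is compared with the derivative of
   a power of x_1 + sqrt(1 + x_1^2). *)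

(** * Integrals of powers of the Japanese bracket *)

Section Integrals.
Variable R : realType.
Local Notation mu := (@lebesgue_measure R).

Lemma is_derive_sqrt1D (x : R) :
  is_derive x 1 (fun t => Num.sqrt (1 + t ^+ 2)) (x / Num.sqrt (1 + x ^+ 2)).
Proof.
have p : 0 < 1 + x ^+ 2 by rewrite ltr_pwDl // sqr_ge0.
have d1 : is_derive x 1 (cst 1 + (id : R -> R) ^+ 2 : R -> R) (2 * x).
  apply: is_derive_eq.
  by rewrite add0r /= /GRing.scale /= mulr1 expr1 mulr_natl.
have := @is_derive1_comp _ _ (cst 1 + id ^+ 2) _ _ _ (is_derive1_sqrt p) d1.
move=> /is_derive_eq; apply.
by field; rewrite gt_eqF // sqrtr_gt0.
Qed.

(** [w] is the exponential of arsinh, so its powers have derivatives proportional to themselves over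
    [sqrt (1 + x ^ 2)]. *)
Let w (x : R) := x + Num.sqrt (1 + x ^+ 2).

Lemma normr_lt_sqrt1D (x : R) : `|x| < Num.sqrt (1 + x ^+ 2).
Proof. by rewrite -sqrtr_sqr ltr_sqrt ?ltrDr // ltr_pwDl // sqr_ge0. Qed.

Let w_gt0 x : 0 < w x.
Proof.
have := normr_lt_sqrt1D x; have := ler_norm (- x); rewrite normrN /w; lra.
Qed.

Let is_derive_w (x : R) : is_derive x 1 w (w x / Num.sqrt (1 + x ^+ 2)).
Proof.
have := is_deriveD (is_derive_id x 1) (is_derive_sqrt1D x).
move=> /is_derive_eq; apply.
rewrite /w; field.
by rewrite gt_eqF // (le_lt_trans (normr_ge0 x)) // normr_lt_sqrt1D.
Qed.

Let is_derive_wpow (a x : R) :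
  is_derive x 1 (fun t => w t `^ a)
    (a * w x `^ a / Num.sqrt (1 + x ^+ 2)).
Proof.
have := is_derive1_comp (is_derive1_powR a (w_gt0 x)) (is_derive_w x).
move=> /is_derive_eq; apply.
have w0 : w x != 0 by rewrite gt_eqF.
have s0 : Num.sqrt (1 + x ^+ 2) != 0.
  by rewrite gt_eqF // (le_lt_trans (normr_ge0 x)) // normr_lt_sqrt1D.
rewrite powRB ?w0 ?implybT // powRr1 ?(ltW (w_gt0 x)) //.
by field; rewrite w0 s0.
Qed.

Lemma powR_cvg_pinfty (a : R) : 0 < a -> x `^ (- a) @[x --> +oo] --> 0.
Proof.
move=> a0; apply/cvgrPdist_lt => e e0; near=> x.
have x0 : 0 < x by near: x; exact: nbhs_pinfty_gt.
rewrite sub0r normrN ger0_norm ?powR_ge0 //.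
(* The threshold for [x] is [e ^ (- 1 / a)]. *)
have -> : e = (e `^ (- a^-1)) `^ (- a).
  by rewrite -powRrM mulrNN mulVf ?gt_eqF // powRr1 // ltW.
rewrite !powRN ltf_pV2 ?posrE ?powR_gt0 //; last first.
  by rewrite invr_gt0 powR_gt0.
rewrite gt0_ltr_powR // ?nnegrE ?invr_ge0 ?powR_ge0 ?ltW //.
Unshelve. all: by end_near. Qed.

Lemma continuous_sqrt1D : continuous (fun x : R => Num.sqrt (1 + x ^+ 2)).
Proof.
move=> x; apply: differentiable_continuous; apply/derivable1_diffP.
exact: (@ex_derive _ _ _ _ _ _ _ (is_derive_sqrt1D x)).
Qed.

Let continuous_wpow (a : R) : continuous (fun t => w t `^ a).
Proof.
move=> x; apply: differentiable_continuous; apply/derivable1_diffP.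
exact: (@ex_derive _ _ _ _ _ _ _ (is_derive_wpow a x)).
Qed.

(* [w ^ (- 2 e)] is, up to a constant factor, a primitive of
   [w ^ (- 2 e) / sqrt (1 + x ^ 2)], and [w <= 2 sqrt (1 + x ^ 2)]. *)
Lemma integral_japanese_le (e : R) : 0 < e ->
  (\int[mu]_x ((1 + x ^+ 2) `^ (- (2^-1 + e)))%:E <= (4 `^ e / e)%:E)%E.
Proof.
move=> e0; have p x : 0 < 1 + x ^+ 2 :> R by rewrite ltr_pwDl // sqr_ge0.
have s0 x : 0 < Num.sqrt (1 + x ^+ 2) :> R by rewrite sqrtr_gt0.
have sn0 x : Num.sqrt (1 + x ^+ 2) != 0 :> R by rewrite gt_eqF.
have powE x : (1 + x ^+ 2) `^ (- (2^-1 + e))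
    = Num.sqrt (1 + x ^+ 2) `^ (- (1 + 2 * e)) :> R.
  by rewrite -powR12_sqrt ?ltW // -powRrM; congr (_ `^ _); field.
have cf : continuous (fun x : R => (1 + x ^+ 2) `^ (- (2^-1 + e))).
  move=> x.
  have D : is_derive x 1
      (fun t : R => Num.sqrt (1 + t ^+ 2) `^ (- (1 + 2 * e))) _
    := @is_derive1_comp _ (fun t => t `^ (- (1 + 2 * e)))
         (fun t => Num.sqrt (1 + t ^+ 2)) _ _ _
         (is_derive1_powR _ (s0 x)) (is_derive_sqrt1D x).
  under eq_fun do rewrite powE.
  have /derivable1_diffP/differentiable_continuous :=
    @ex_derive _ _ _ _ _ _ _ D.
  exact.
pose g x : R := 4 `^ e * (w x `^ (- (2 * e)) / Num.sqrt (1 + x ^+ 2)).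
have cg : continuous g.
  move=> x; apply: cvgM; first exact: cvg_cst.
  apply: cvgM; first exact: continuous_wpow.
  by apply: cvgV; [rewrite gt_eqF|exact: continuous_sqrt1D].
have g0 x : 0 <= g x by rewrite mulr_ge0 ?powR_ge0 // divr_ge0 ?powR_ge0 ?ltW.
have fg x : 0 <= x -> (1 + x ^+ 2) `^ (- (2^-1 + e)) <= g x.
  move=> x0; rewrite powE opprD powRD ?sn0 ?implybT //.
  rewrite powR_inv1 ?sqrtr_ge0 // /g mulrA [X in X <= _]mulrC.
  rewrite ler_wpM2r ?invr_ge0 ?sqrtr_ge0 //.
  (* The constant becomes a power with the exponent of [w], so it merges with it into a power of
     [w / 2], and [w / 2 <= sqrt (1 + x ^ 2)]. *)
  have -> : 4 `^ e = (2^-1) `^ (- (2 * e)) :> R.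
    rewrite -[2^-1]powR_inv1 // -powRrM mulN1r opprK powRrM.
    by congr (_ `^ _); rewrite powR_mulrn //; ring.
  rewrite -powRM ?invr_ge0 ?(ltW (w_gt0 x)) //.
  rewrite !powRN lef_pV2 ?posrE ?powR_gt0 ?mulr_gt0 ?invr_gt0 //.
  have e2 : 0 <= 2 * e by rewrite mulr_ge0 // ltW.
  have w2 : 2^-1 * w x <= Num.sqrt (1 + x ^+ 2).
    by have := normr_lt_sqrt1D x; rewrite ger0_norm // /w => H; lra.
  apply: ge0_ler_powR => //; rewrite nnegrE ?sqrtr_ge0 //.
  by rewrite mulr_ge0 // ltW.
pose f x : R := (1 + x ^+ 2) `^ (- (2^-1 + e)).
have evenf : f =1 f \o -%R by move=> x; rewrite /f /= sqrrN.
(* The comparison is made on the half line only, because [w ^ (- 2 e)] blows up at -oo; evenness of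
   [f] supplies the factor 2. *)
rewrite (ge0_symfun_integralT (f := f) _ cf evenf); last first.
  by move=> x; exact: powR_ge0.
rewrite -set_itvcy.
apply: (@le_trans _ _ (2%:E * \int[mu]_(x in `[0%R, +oo[) (g x)%:E)%E).
  rewrite lee_pmul2l //; apply: ge0_le_integral => //=.
  - by move=> x _; rewrite lee_fin powR_ge0.
  - by apply/measurable_EFinP/measurable_funTS; exact: continuous_measurable_fun.
  - by apply/measurable_EFinP/measurable_funTS; exact: continuous_measurable_fun.
  - by move=> x; rewrite in_itv /= andbT lee_fin; exact: fg.
(* [F] vanishes at +oo and [w 0 = 1], so [g] integrates to [4 ^ e / (2 e)]; doubling gives the
   bound. *)
pose F : R -> R := fun x => - (4 `^ e / (2 * e)) * w x `^ (- (2 * e)).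
have dF (x : R) : is_derive x 1 F (g x).
  have -> : F = (- (4 `^ e / (2 * e))) *: (fun t => w t `^ (- (2 * e))) by [].
  have := @is_deriveZ _ _ _ _ (- (4 `^ e / (2 * e))) _ _ _
    (is_derive_wpow (- (2 * e)) x).
  move=> /is_derive_eq; apply; rewrite /GRing.scale /= /g.
  by field; rewrite !gt_eqF.
rewrite (@ge0_continuous_FTC2y _ g F 0 0) //.
- have w0 : w 0 = 1 by rewrite /w expr0n /= addr0 sqrtr1 add0r.
  rewrite /F w0 powR1 mulr1 sub0e -EFinN opprK.
  rewrite -EFinM lee_fin le_eqVlt; apply/orP; left; apply/eqP.
  by field; rewrite gt_eqF.
- exact: continuous_subspaceT.
- rewrite -(mulr0 (- (4 `^ e / (2 * e)))); apply: cvgM; first exact: cvg_cst.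
  (* The squeeze uses [x <= w x]. *)
  apply: (@squeeze_cvgr _ _ _ _ (cst 0) (fun x => x `^ (- (2 * e)))).
  + near=> x.
    have x0 : 0 < x by near: x; exact: nbhs_pinfty_gt.
    rewrite powR_ge0 /= !powRN lef_pV2 ?posrE ?powR_gt0 //.
    apply: ge0_ler_powR; rewrite ?nnegrE ?(ltW x0) ?(ltW (w_gt0 x)) //.
      by rewrite mulr_ge0 // ltW.
    by rewrite /w lerDl sqrtr_ge0.
  + exact: cvg_cst.
  + by apply: powR_cvg_pinfty; rewrite mulr_gt0.
- apply: cvg_at_right_filter; apply: differentiable_continuous.
  exact/derivable1_diffP.
- by move=> x _; rewrite derive1E derive_val.
Unshelve. all: by end_near. Qed.

End Integrals.

(** * Comparison of integrals under an almost everywhere bound *)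

Section Domination.
Import HBNNSimple.

(** Only the majorant is assumed measurable, so the bound applies directly to an integrand composed
    with the displacements. *)
Lemma ae_le_integral d (T : measurableType d) (R : realType)
    (mu : {measure set T -> \bar R}) (f g : T -> \bar R) :
  (forall x, 0 <= f x)%E -> (forall x, 0 <= g x)%E -> measurable_fun setT g ->
  {ae mu, forall x, f x <= g x}%E ->
  (\int[mu]_x f x <= \int[mu]_x g x)%E.
Proof.
move=> f0 g0 mg fg; rewrite ge0_integralTE //.
(* The integral of [f] is a supremum over the simple functions below [f]. *)
apply: ge_ereal_sup => _ [h /= hf <-].
have := integral_nnsfun mu measurableT h; rewrite patch_setT => <-.
apply: ae_ge0_le_integral => //.
- by move=> x _; rewrite lee_fin.
- exact/measurable_EFinP.
- by apply: filterS fg => x fgx _; exact: le_trans (hf x) fgx.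
Qed.

End Domination.

(** * The bracket integral over the plane, by Tonelli *)

Section Planar_integral.
Variable R : realType.
Local Notation mu := (@lebesgue_measure R).

Lemma integral_inv_sqrD (s : R) : 0 < s ->
  (\int[mu]_y ((s + y ^+ 2)^-1)%:E = (pi / Num.sqrt s)%:E)%E.
Proof.
move=> s0; set a := Num.sqrt s.
have a0 : 0 < a by rewrite sqrtr_gt0.
have sE : s = a ^+ 2 by rewrite sqr_sqrtr // ltW.
(* A primitive of the integrand, with limit [pi / (2 a)] at +oo. *)
pose F : R -> R := fun y => a^-1 * atan (a^-1 * y).
pose f : R -> R := fun y => (s + y ^+ 2)^-1.
have p (y : R) : 0 < s + y ^+ 2 by rewrite ltr_pwDl // sqr_ge0.
have dF (y : R) : is_derive y 1 F (f y).
  have D1 : is_derive y 1 (a^-1 *: (id : R -> R) : R -> R) a^-1.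
    by apply: is_derive_eq; rewrite /GRing.scale /= mulr1.
  have D2 := is_deriveZ a^-1 (@is_derive1_comp _ atan
    (fun t : R => a^-1 * t) _ _ _ (is_derive1_atan _) D1).
  move: D2 => /is_derive_eq; apply; rewrite /f sE /GRing.scale /=.
  have := p y; rewrite sE => /gt_eqF/negbT py.
  field; rewrite py gt_eqF //=.
have cf : continuous f.
  move=> y; apply: cvgV; first by rewrite gt_eqF.
  apply: cvgD; first exact: cvg_cst.
  exact: exprn_continuous.
have f0 y : 0 <= f y by rewrite invr_ge0 ltW.
have evenf : f =1 f \o -%R by move=> y; rewrite /f /= sqrrN.
rewrite (ge0_symfun_integralT (f := f) f0 cf evenf) -set_itvcy.
rewrite (@ge0_continuous_FTC2y _ f F 0 (a^-1 * (pi / 2))) //.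
- rewrite /F mulr0 atan0 mulr0 sube0 -EFinM; congr EFin.
  by field; rewrite gt_eqF.
- exact: continuous_subspaceT.
- apply: cvgM; first exact: cvg_cst.
  have scaled : a^-1 * y @[y --> +oo] --> +oo.
    by apply: gt0_cvgMry; [rewrite invr_gt0|exact: cvg_id].
  exact: cvg_comp scaled (@cvgy_atan R).
- apply: cvg_at_right_filter; apply: differentiable_continuous.
  exact/derivable1_diffP.
- by move=> x _; rewrite derive1E derive_val.
Qed.

Lemma measurable_japanese2 (s : R) :
  measurable_fun [set: measurableTypeR R * measurableTypeR R]
    (fun x => ((1 + x.1 ^+ 2 + x.2 ^+ 2) `^ s)%:E).
Proof.
apply/measurable_EFinP.
apply: (measurableT_comp (@measurable_powR R s)).
apply: measurable_funD; last exact: measurable_funX.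
by apply: measurable_funD => //; exact: measurable_funX.
Qed.

Lemma integral_japanese2_le (r : R) : 1 < r ->
  (\int[lebesgue2]_x ((1 + x.1 ^+ 2 + x.2 ^+ 2) `^ (- r))%:E
     <= (4 `^ (r - 1) * pi / (r - 1))%:E)%E.
Proof.
move=> r1; have e0 : 0 < r - 1 by rewrite subr_gt0.
pose k (x : R2 R) := ((1 + x.1 ^+ 2 + x.2 ^+ 2) `^ (- r))%:E.
have mk : measurable_fun setT k := measurable_japanese2 (- r).
have k0 x : (0 <= k x)%E by rewrite lee_fin powR_ge0.
have := fubini_tonelli1 (m1 := mu) (m2 := mu) k mk k0; rewrite /k /= => ->.
(* The exponent adds [r - 1], split off before the inner integration, and 1/2 from the [sqrt s] that
   it produces. *)
apply: (@le_trans _ _ (\int[mu]_x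
    (pi%:E * ((1 + x ^+ 2) `^ (- (2^-1 + (r - 1))))%:E))%E); last first.
  rewrite ge0_integralZl //; last 3 first.
    - apply/measurable_EFinP; apply: (measurableT_comp (@measurable_powR R _)).
      by apply: measurable_funD => //; exact: measurable_funX.
    - by move=> x _; rewrite lee_fin powR_ge0.
    - by rewrite lee_fin pi_ge0.
  apply: (@le_trans _ _ (pi%:E * (4 `^ (r - 1) / (r - 1))%:E)%E).
    by rewrite lee_wpmul2l ?lee_fin ?pi_ge0 //; exact: integral_japanese_le.
  by rewrite -EFinM lee_fin mulrCA mulrA.
apply: ge0_le_integral => //.
- by move=> x _; apply: integral_ge0 => y _; rewrite lee_fin powR_ge0.
- exact: measurable_fun_fubini_tonelli_F.
- apply: measurable_funeM; apply/measurable_EFinP.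
  apply: (measurableT_comp (@measurable_powR R _)).
  by apply: measurable_funD => //; exact: measurable_funX.
move=> x _; rewrite /fubini_F.
set s := 1 + x ^+ 2.
have s0 : 0 < s by rewrite ltr_pwDl // sqr_ge0.
have p (y : R) : 0 < s + y ^+ 2 by rewrite ltr_pwDl // sqr_ge0.
have mi : measurable_fun setT (fun y : R => ((s + y ^+ 2)^-1)%:E).
  apply/measurable_EFinP; apply: continuous_measurable_fun => y.
  apply: cvgV; first by rewrite gt_eqF.
  by apply: cvgD; [exact: cvg_cst|exact: exprn_continuous].
apply: (@le_trans _ _ (\int[mu]_y
    ((s `^ (- (r - 1)))%:E * ((s + y ^+ 2)^-1)%:E))%E).
  apply: ge0_le_integral => //.
  - by move=> y _; rewrite lee_fin powR_ge0.
  - exact: (measurableT_comp mk (pair1_measurable x)).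
  - by apply: measurable_funeM.
  move=> y _; rewrite -EFinM lee_fin /= -/s.
  have -> : - r = - (r - 1) + -1 by ring.
  have py : s + y ^+ 2 != 0 by rewrite gt_eqF.
  rewrite powRD ?py ?implybT // powR_inv1 ?(ltW (p y)) //.
  rewrite ler_wpM2r ?invr_ge0 ?(ltW (p y)) // !powRN lef_pV2 ?posrE ?powR_gt0 //.
  apply: ge0_ler_powR; rewrite ?nnegrE ?(ltW (p y)) ?(ltW s0) ?(ltW e0) //.
  by rewrite lerDl sqr_ge0.
rewrite ge0_integralZl //; last 2 first.
  by move=> y _; rewrite lee_fin invr_ge0 ltW.
  by rewrite lee_fin powR_ge0.
have sn0 : s != 0 by rewrite gt_eqF.
rewrite integral_inv_sqrD // -!EFinM lee_fin [- (2^-1 + _)]opprD.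
rewrite powRD ?sn0 ?implybT //.
rewrite [s `^ (- 2^-1)]powRN powR12_sqrt ?(ltW s0) //.
by rewrite le_eqVlt; apply/orP; left; apply/eqP; ring.
Qed.

End Planar_integral.

Set Implicit Arguments.
Unset Strict Implicit.

(** * Null sets under affine maps *)

(** By uniqueness of Lebesgue measure: [|a|] times the pushforward has the right value on half-open
    intervals. *)
Lemma lebesgue_measure_affine (R : realType) (a b : R) (S : set R) :
  a != 0 -> measurable S ->
  @lebesgue_measure R ((fun x => a * x + b) @^-1` S)
   = (`|a|^-1%:E * lebesgue_measure S)%E.
Proof.
move=> a0 mS.
have na0 : 0 < `|a| by rewrite normr_gt0.
pose h : measurableTypeR R -> measurableTypeR R := fun x => a * x + b.
have mh : measurable_fun setT h.
  by apply: measurable_funD => //; apply: measurable_funM.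
have [nu nuE] : exists nu : {measure set (measurableTypeR R) -> \bar R},
    forall A, nu A = lebesgue_measure (h @^-1` A).
  by unshelve eexists (pushforward (@lebesgue_measure R) h).
pose k : {nonneg R} := NngNum (ltW na0).
suff H : forall A, measurable A -> lebesgue_measure A = mscale k nu A.
  by rewrite [in RHS]H// /mscale /= muleA -EFinM mulVf ?gt_eqF// mul1e nuE.
apply: lebesgue_measure_unique => _ [[x y]] /= _ <-.
rewrite /mscale /= nuE.
have [a_gt0|a_lt0|/eqP] := ltgtP 0 a; last by rewrite eq_sym (negbTE a0).
- have -> : h @^-1` `]x, y] = `](x - b) / a, (y - b) / a]%classic.
    apply/seteqP; split => t /=; rewrite !in_itv /= /h => /andP[];
      rewrite ?ltr_pdivrMr ?ler_pdivlMr // => t1 t2; apply/andP; split; lra.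
  rewrite !lebesgue_measure_itv /= !lte_fin gtr0_norm // ltr_pM2r ?invr_gt0 //.
  rewrite ltrD2r; case: ifP => _; last by rewrite mule0.
  rewrite -!EFinD -EFinM; congr EFin; field; exact: a0.
(* A negative slope exchanges the endpoints, so the closed end is now on the left. *)
- have -> : h @^-1` `]x, y] = `[(y - b) / a, (x - b) / a[%classic.
    apply/seteqP; split => t /=; rewrite !in_itv /= /h => /andP[];
      rewrite ?ltr_ndivlMr ?ler_ndivrMr // => t1 t2; apply/andP; split; lra.
  rewrite !lebesgue_measure_itv /= !lte_fin ltr0_norm // ltr_nM2r ?invr_lt0 //.
  rewrite ltrD2r; case: ifP => _; last by rewrite mule0.
  rewrite -!EFinD -EFinM; congr EFin; field; exact: a0.
Qed.

Section Planar.
Variable R : realType.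
Implicit Types (S : set (R2 R)) (M : 'M[R]_2).

Lemma lebesgue2_xsection S :
  lebesgue2 S = (\int[lebesgue_measure]_x lebesgue_measure (xsection S x))%E.
Proof. by []. Qed.

(** The product measure is defined through x-sections; its uniqueness gives the other order of
    integration. *)
Lemma lebesgue2_ysection S : measurable S ->
  lebesgue2 S = (\int[lebesgue_measure]_y lebesgue_measure (ysection S y))%E.
Proof.
move=> mS; rewrite /lebesgue2.
rewrite (product_measure_unique (m' := (lebesgue_measure \x^ lebesgue_measure)%E)) //.
by move=> A B mA mB; exact: product_measure2E.
Qed.

(** For fixed second coordinate the map is affine in the first, so each section of a null cover has
    its measure scaled by [1 / |a|], and the integral stays 0. *)
Lemma negligible_preimage_fst S (a b e : R) : a != 0 ->
  lebesgue2.-negligible S ->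
  lebesgue2.-negligible ((fun p => (a * p.1 + b * p.2 + e, p.2)) @^-1` S).
Proof.
move=> a0 [A [mA A0 SA]].
set h := (X in X @^-1` _).
have mh : measurable_fun [set: measurableTypeR R * measurableTypeR R] h.
  apply: measurable_fun_pair => //.
  do 2 (apply: measurable_funD => //).
    by apply: measurable_funM.
  by apply: measurable_funM.
have mhA : measurable (h @^-1` A) by rewrite -[X in measurable X]setTI; exact: mh.
exists (h @^-1` A); split => //; last exact: preimage_subset.
rewrite lebesgue2_ysection //.
under eq_integral => y _.
  have -> : ysection (h @^-1` A) y
      = (fun x => a * x + (b * y + e)) @^-1` ysection A y.
    by apply/seteqP; split => x; rewrite /ysection /= !inE /h /= addrA.
  rewrite lebesgue_measure_affine //; last exact: measurable_ysection.
  over.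
rewrite ge0_integralZl//; last exact: measurable_fun_ysection.
by rewrite -[X in (_ * X)%E]lebesgue2_ysection// A0 mule0.
Qed.

Lemma negligible_preimage_snd S (c d e : R) : d != 0 ->
  lebesgue2.-negligible S ->
  lebesgue2.-negligible ((fun p => (p.1, c * p.1 + d * p.2 + e)) @^-1` S).
Proof.
move=> d0 [A [mA A0 SA]].
set h := (X in X @^-1` _).
have mh : measurable_fun [set: measurableTypeR R * measurableTypeR R] h.
  apply: measurable_fun_pair => //.
  do 2 (apply: measurable_funD => //).
    by apply: measurable_funM.
  by apply: measurable_funM.
have mhA : measurable (h @^-1` A) by rewrite -[X in measurable X]setTI; exact: mh.
exists (h @^-1` A); split => //; last exact: preimage_subset.
rewrite lebesgue2_xsection //.
under eq_integral => x _.
  have -> : xsection (h @^-1` A) x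
      = (fun y => d * y + (c * x + e)) @^-1` xsection A x.
    apply/seteqP; split => y; rewrite /xsection /= !inE /h /=.
      by rewrite addrA [d * y + _]addrC.
    by rewrite addrA [d * y + _]addrC.
  rewrite lebesgue_measure_affine //; last exact: measurable_xsection.
  over.
rewrite ge0_integralZl//; last exact: measurable_fun_xsection.
by rewrite -[X in (_ * X)%E]lebesgue2_xsection// A0 mule0.
Qed.

Lemma det2 M : \det M = M 0 0 * M 1 1 - M 0 1 * M 1 0.
Proof.
rewrite (expand_det_row _ 0) !big_ord_recl big_ord0 addr0 /cofactor.
rewrite !det_mx11 !mxE /= expr0 mul1r.
have -> : lift 0 0 = 1 :> 'I_2 by exact/val_inj.
have -> : lift 1 0 = 0 :> 'I_2 by exact/val_inj.
by rewrite expr1 mulN1r mulrN.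
Qed.

(* An affine map whose upper left entry is nonzero is a composition of two
   shears as above; a zero entry is first made nonzero by a shear. *)
Lemma negligible_preimage_affine S M t : M \in unitmx ->
  lebesgue2.-negligible S ->
  lebesgue2.-negligible ((fun x => mulv M x + t) @^-1` S).
Proof.
rewrite unitmxE unitfE det2 => detM.
have key a b c d (s : R2 R) T : a != 0 -> a * d - b * c != 0 ->
    lebesgue2.-negligible T ->
    lebesgue2.-negligible
      ((fun x => (a * x.1 + b * x.2 + s.1, c * x.1 + d * x.2 + s.2)) @^-1` T).
  move=> a0 dt nT.
  have d'0 : (a * d - b * c) / a != 0 by rewrite mulf_neq0 ?invr_eq0.
  (* The second row is [c / a] times the first plus [(a d - b c) / a] times the second coordinate;
     the offset [s.2 - c / a * s.1] corrects the translation. *)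
  have := negligible_preimage_fst b s.1 a0
    (negligible_preimage_snd (c / a) (s.2 - c / a * s.1) d'0 nT).
  congr (lebesgue2.-negligible _); apply/funext => x /=; congr (T (_, _)).
  by field.
move=> nS; have [a0|a0] := eqVneq (M 0 0) 0; last first.
  exact: (key (M 0 0) (M 0 1) (M 1 0) (M 1 1) t).
have c0 : M 1 0 != 0.
  by apply: contra detM => /eqP ->; rewrite a0 mul0r mulr0 subrr.
(* Adding the second row to the first keeps the determinant and makes the corner entry [M 1 0]; the
   shear with coefficient -1 undoes it. *)
have dt : M 1 0 * M 1 1 - (M 0 1 + M 1 1) * M 1 0 != 0.
  apply: contra detM => /eqP dt; apply/eqP; rewrite a0 -[RHS]dt; ring.
have := key _ _ _ _ (t.1 + t.2, t.2) _ c0 dt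
  (negligible_preimage_fst (-1) 0 (oner_neq0 R) nS).
congr (lebesgue2.-negligible _); apply/funext => x /=; congr (S (_, _)).
by rewrite /= ?a0; ring.
Qed.

End Planar.

(** * The moire lattice and almost everywhere bounds *)

(** Lets almost everywhere statements for the planar measure be weakened and combined as filter
    statements. *)
#[local] Instance ae_lebesgue2_filter (R : realType) :
  Filter (nbhs (almost_everywhere (@lebesgue2 R))).
Proof. exact: (ae_filter_ringOfSetsType (@lebesgue2 R)). Qed.

(** * Invertibility of the matrices of the bilayer *)

Section Linear.
Variable R : realType.
Implicit Types (M N : 'M[R]_2) (x y : R2 R) (p : R3 R).

Lemma mulvD M x y : mulv M (x + y) = mulv M x + mulv M y.
Proof. by congr (_, _); rewrite /=; ring. Qed.

Lemma mulvB M x y : mulv M (x - y) = mulv M x - mulv M y.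
Proof. by congr (_, _); rewrite /=; ring. Qed.

Lemma mulvBl M N x : mulv (M - N) x = mulv M x - mulv N x.
Proof. by congr (_, _); rewrite /= !mxE; ring. Qed.

Lemma mulmxv M N x : mulv (M *m N) x = mulv M (mulv N x).
Proof.
rewrite /mulv !mxE !big_ord_recl !big_ord0 /=.
have -> : lift 0 0 = 1 :> 'I_2 by exact/val_inj.
by congr (_, _); rewrite /=; ring.
Qed.

Lemma mul1v x : mulv 1%:M x = x.
Proof. by case: x => a b; rewrite /mulv !mxE /=; congr (_, _); ring. Qed.

Lemma mulVv M x : M \in unitmx -> mulv (invmx M) (mulv M x) = x.
Proof. by move=> uM; rewrite -mulmxv mulVmx // mul1v. Qed.

Lemma mulvV M x : M \in unitmx -> mulv M (mulv (invmx M) x) = x.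
Proof. by move=> uM; rewrite -mulmxv mulmxV // mul1v. Qed.

Lemma unitmx_rotation (phi : R) : rotation phi \in unitmx.
Proof.
by rewrite unitmxE det2 !mxE /= mulNr opprK -!expr2 cos2Dsin2 unitr1.
Qed.

Lemma unitmx_layer (q theta : R) (A : 'M[R]_2) j : 0 < q -> A \in unitmx ->
  layer_mx q theta A j \in unitmx.
Proof.
move=> q0 uA; have p s : q `^ s \is a GRing.unit.
  by rewrite unitfE gt_eqF // powR_gt0.
by case: j; rewrite /layer_mx unitmxZ // unitmx_mul unitmx_rotation.
Qed.

(* The difference is a conformal matrix times [A], so it is singular only if it
   vanishes, and then the two lattices coincide. *)
Lemma unitmx_layerB (q theta : R) (A : 'M[R]_2) : 0 < q -> A \in unitmx ->
  incommensurate q theta A ->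
  layer_mx q theta A L1 - layer_mx q theta A L2 \in unitmx.
Proof.
move=> q0 uA [_ disjoint].
have uA1 := unitmx_layer theta L1 q0 uA.
have A12 : layer_mx q theta A L1 != layer_mx q theta A L2.
  apply/eqP => A12.
  have : [set 0 : R2 R] (mulv (layer_mx q theta A L1) (1, 0)).
    by rewrite -disjoint; split; rewrite -?A12; exists (1, 0).
  move=> /= /(congr1 (mulv (invmx (layer_mx q theta A L1)))).
  rewrite mulVv // /mulv /= !mulr0 addr0 => -[/eqP].
  by rewrite oner_eq0.
have E : layer_mx q theta A L1 - layer_mx q theta A L2 =
    (q `^ (- 2^-1) *: rotation (- (theta / 2))
     - q `^ 2^-1 *: rotation (theta / 2)) *m A.
  by rewrite mulmxBl -!scalemxAl.
rewrite E unitmx_mul uA andbT unitmxE det2 !mxE /= cosN sinN unitfE.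
set c := cos _; set s := sin _; set a := q `^ _; set b := q `^ _.
(* The determinant is a sum of two squares, and these vanish together only if all four entries
   do. *)
have -> : (a * c - b * c) * (a * c - b * c)
    - (a * (- - s) - b * (- s)) * (a * (- s) - b * s)
    = (a * c - b * c) ^+ 2 + (a * s + b * s) ^+ 2 by ring.
apply: contra A12; rewrite paddr_eq0 ?sqr_ge0 // !sqrf_eq0.
move=> /andP[/eqP ac /eqP as_]; rewrite -subr_eq0 E.
rewrite (_ : _ - _ = 0) ?mul0mx //; apply/matrixP => i k.
rewrite !mxE cosN sinN -/c -/s -/a -/b.
by case: ifP => _; case: ifP => _; lra.
Qed.

Lemma unitmxN M : (- M \in unitmx) = (M \in unitmx).
Proof. by rewrite -scaleN1r unitmxZ // unitrN1. Qed.

(** The resolvent identity factors the difference; it makes the outer [invmx] of [moire_mx] a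
    genuine inverse. *)
Lemma unitmx_invB M N : M \in unitmx -> N \in unitmx -> M - N \in unitmx ->
  invmx M - invmx N \in unitmx.
Proof.
move=> uM uN uMN.
have -> : invmx M - invmx N = - (invmx M *m (M - N) *m invmx N).
  by rewrite mulmxBr mulVmx // mulmxBl mul1mx mulmxK // opprB.
by rewrite unitmxN !unitmx_mul !unitmx_inv uM uMN uN.
Qed.

Lemma unitmx_moire (q theta : R) (A : 'M[R]_2) : 0 < q -> A \in unitmx ->
  incommensurate q theta A -> moire_mx q theta A \in unitmx.
Proof.
move=> q0 uA inc; rewrite unitmx_inv unitmx_invB ?unitmx_layer //.
exact: unitmx_layerB.
Qed.

Lemma unitmx_disregistry (q theta : R) (A : 'M[R]_2) j : 0 < q ->
  A \in unitmx -> incommensurate q theta A ->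
  disregistry_mx q theta A j \in unitmx.
Proof.
move=> q0 uA inc; have uL k := unitmx_layer theta k q0 uA.
have -> : disregistry_mx q theta A j
    = (layer_mx q theta A j - layer_mx q theta A (other j))
        *m invmx (layer_mx q theta A j).
  by rewrite mulmxBl mulmxV.
rewrite unitmx_mul unitmx_inv uL andbT.
case: j; rewrite /other; first exact: unitmx_layerB.
by rewrite -opprB unitmxN unitmx_layerB.
Qed.

(** This matrix is the linear part of [y -> D^-1 (y + gamma) - y], where the displacement of the
    other layer is evaluated. *)
Lemma unitmx_disregistry_invB1 (q theta : R) (A : 'M[R]_2) j : 0 < q ->
  A \in unitmx -> incommensurate q theta A ->
  invmx (disregistry_mx q theta A j) - 1%:M \in unitmx.
Proof.
move=> q0 uA inc; have uD := unitmx_disregistry j q0 uA inc.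
have -> : invmx (disregistry_mx q theta A j) - 1%:M
    = invmx (disregistry_mx q theta A j)
        *m (layer_mx q theta A (other j) *m invmx (layer_mx q theta A j)).
  have -> : layer_mx q theta A (other j) *m invmx (layer_mx q theta A j)
      = 1%:M - disregistry_mx q theta A j by rewrite opprB addrC subrK.
  by rewrite mulmxBr mulmx1 mulVmx.
by rewrite !unitmx_mul !unitmx_inv uD !unitmx_layer.
Qed.

End Linear.

(** * From bounds on a cell to bounds on the plane *)

Section Almost_everywhere.
Variable R : realType.
Implicit Types M : 'M[R]_2.

(* Up to lattice translations, an exceptional point lies in the unit cell. *)
Lemma ae_periodic M (P : R2 R -> Prop) : M \in unitmx ->
  (forall x t, lattice M t -> P (x + t) -> P x) ->
  {ae lebesgue2, forall x, cell M x -> P x} -> {ae lebesgue2, forall x, P x}.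
Proof.
move=> uM per aeP.
have nS : lebesgue2.-negligible [set x | cell M x /\ ~ P x].
  by apply: negligibleS aeP => x [cx nPx] /= /(_ cx).
(* Lattice translates of the exceptional set, enumerated by natural numbers; the identity matrix
   presents a translation as an affine map. *)
pose F k := if unpickle k is Some n then
  (fun x => mulv 1%:M x - mulv M (n.1%:~R, n.2%:~R))
    @^-1` [set x | cell M x /\ ~ P x]
  else set0 : set (R2 R).
have nF k : lebesgue2.-negligible (F k).
  rewrite /F; case: unpickle => [n|]; last exact: negligible_set0.
  by apply: negligible_preimage_affine => //; exact: unitmx1.
apply: (negligibleS _ (negligible_bigcup nF)) => x /= nPx.
pose y := mulv (invmx M) x.
(* The integer parts of the lattice coordinates of [x] give the translate that contains it. *)
pose n : int * int := (Num.floor y.1, Num.floor y.2).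
exists (pickle n) => //; rewrite /F pickleK /= mul1v.
have E : x - mulv M (n.1%:~R, n.2%:~R) = mulv M (y - (n.1%:~R, n.2%:~R)).
  by rewrite mulvB mulvV.
have itvB (a : R) : `[0, 1[%classic (a - (Num.floor a)%:~R).
  rewrite /= in_itv /= subr_ge0 floor_le ltrBlDl.
  by have := floorD1_gt a; rewrite intrD.
split.
  by rewrite E; exists (y - (n.1%:~R, n.2%:~R)) => //; split; exact: itvB.
move=> PE; apply: nPx.
apply: (per x (- mulv M (n.1%:~R, n.2%:~R))) => //.
exists (- n.1, - n.2) => //.
by congr (_, _); rewrite /= !mulrNz; ring.
Qed.

Lemma Linfty_norm_ae (D : set (R2 R)) (h : R2 R -> R) :
  (Linfty_norm D h < +oo)%E ->
  {ae lebesgue2, forall x, D x -> `|h x| <= fine (Linfty_norm D h)}.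
Proof.
set l := Linfty_norm D h => loo.
have l0 : (0 <= l)%E by exact: Lnorm_ge0.
have lE : l = (fine l)%:E by rewrite fineK // ge0_fin_numE.
have aeb : {ae lebesgue2, forall x, (`|((h \_ D) x)%:E| <= l)%E}.
  (* The norm is the essential supremum when the whole space has positive measure; otherwise every
     set is negligible. *)
  move: lE l0 loo; rewrite /l /Linfty_norm unlock; case: ifPn => [_ _ _ _|].
    exact: ess_sup_ge.
  rewrite lt0e measure_ge0 andbT negbK => /eqP T0 _ _ _.
  by exists setT; split.
apply: filterS aeb => x; rewrite lE /= lee_fin patchE => + Dx.
by rewrite mem_set.
Qed.

Lemma Linfty_norm_le (D : set (R2 R)) (h k : R2 R -> R) :
  (forall x, `|h x| <= `|k x|) -> (Linfty_norm D h <= Linfty_norm D k)%E.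
Proof.
move=> hk; rewrite /Linfty_norm unlock; case: ifPn => // _.
apply: le_ess_sup; apply: nearW => x /=; rewrite !patchE lee_fin.
by case: ifP => // _; rewrite normr0.
Qed.

End Almost_everywhere.

(** * The Euclidean norm and its weight under a bounded shift *)

Section Euclidean_norm.
Variable R : realType.
Implicit Types p s : R3 R.

Lemma enorm_ge0 p : 0 <= enorm p.
Proof. exact: sqrtr_ge0. Qed.

Lemma enorm_sqr p : enorm p ^+ 2 = p.1.1 ^+ 2 + p.1.2 ^+ 2 + p.2 ^+ 2.
Proof. by rewrite sqr_sqrtr // !addr_ge0 ?sqr_ge0. Qed.

Lemma ler_enormD p s : enorm (p + s) <= enorm p + enorm s.
Proof.
have pos : 0 <= enorm p + enorm s by rewrite addr_ge0 ?enorm_ge0.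
rewrite -(ler_pXn2r (_ : 0 < 2)%N) ?nnegrE ?enorm_ge0 //.
rewrite sqrrD !enorm_sqr /=.
suff : p.1.1 * s.1.1 + p.1.2 * s.1.2 + p.2 * s.2 <= enorm p * enorm s.
  move=> H; rewrite !sqrrD; lra.
apply: le_trans (ler_norm _) _.
rewrite -(ler_pXn2r (_ : 0 < 2)%N) ?nnegrE ?mulr_ge0 ?enorm_ge0 //.
rewrite real_normK ?num_real // exprMn !enorm_sqr -subr_ge0.
(* Lagrange's identity, hence Cauchy-Schwarz. *)
have -> : forall a b c x y z : R,
    (a ^+ 2 + b ^+ 2 + c ^+ 2) * (x ^+ 2 + y ^+ 2 + z ^+ 2)
    - (a * x + b * y + c * z) ^+ 2
    = (a * y - b * x) ^+ 2 + (a * z - c * x) ^+ 2 + (b * z - c * y) ^+ 2.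
  by move=> *; ring.
by rewrite !addr_ge0 ?sqr_ge0.
Qed.

Lemma enormN p : enorm (- p) = enorm p.
Proof. by rewrite /enorm /= !sqrrN. Qed.

Lemma ler_enorm3 p : `|p.2| <= enorm p.
Proof. by rewrite -sqrtr_sqr ler_wsqrtr // lerDr addr_ge0 ?sqr_ge0. Qed.

(** A form of Peetre's inequality, from the triangle inequality [|x| <= |x + p| + C]. *)
Lemma japanese_shift_le (x : R2 R) p (C : R) : enorm p <= C ->
  1 + x.1 ^+ 2 + x.2 ^+ 2 <= (1 + C) ^+ 2 * japanese (flat x + p) ^+ 2.
Proof.
move=> pC; rewrite sqr_sqrtr ?addr_ge0 ?sqr_ge0 //.
have -> : 1 + x.1 ^+ 2 + x.2 ^+ 2 = 1 + enorm (flat x) ^+ 2.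
  by rewrite enorm_sqr /= expr0n addr0 addrA.
have C0 : 0 <= C := le_trans (enorm_ge0 p) pC.
have := enorm_ge0 (flat x); set s := enorm (flat x + p).
have s0 : 0 <= s := enorm_ge0 _.
have : enorm (flat x) <= s + C.
  have -> : flat x = (flat x + p) - p by rewrite addrK.
  by apply: le_trans (ler_enormD _ _) _; rewrite enormN lerD2l.
move: (enorm _) => t tsC t0.
have : t ^+ 2 <= (s + C) ^+ 2 by rewrite ler_pXn2r ?nnegrE ?addr_ge0.
(* The product [(1 + C)^2 (1 + s^2)] exceeds [1 + (s + C)^2] by [2 C (1 + s^2 - s) + C^2 s^2]. *)
have : 0 <= C * (1 + s ^+ 2 - s).
  by rewrite mulr_ge0 //; nra.
have : 0 <= C ^+ 2 * s ^+ 2 by rewrite mulr_ge0 ?sqr_ge0.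
nra.
Qed.

End Euclidean_norm.

(** * Bounds on shift vectors and displacements *)

Lemma shift_diam_ge (R : realType) (sites : layer -> finType)
    (tau : forall k, sites k -> R2 R) j (alpha : forall k, sites k) :
  enorm (flat (tau _ (alpha j)) - flat (tau _ (alpha (other j))))
    <= shift_diam tau.
Proof.
have le12 : enorm (flat (tau _ (alpha L1)) - flat (tau _ (alpha L2)))
    <= shift_diam tau.
  apply: le_trans (le_bigmax _ _ (alpha L1)).
  apply: le_trans (le_bigmax _ _ (alpha L2)).
  by rewrite /enorm /= subrr.
by case: j => //=; rewrite -enormN opprB.
Qed.

Lemma ae_displacement_le (R : realType) (q theta : R) (A : 'M[R]_2)
    (sites : layer -> finType) (u : forall k, sites k -> R2 R -> R3 R)
    k (a : sites k) :
  0 < q -> A \in unitmx -> incommensurate q theta A ->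
  moire_periodic q theta A u -> Linfty (cell (moire_mx q theta A)) (u k a) ->
  {ae lebesgue2, forall x, enorm (u k a x) <= disp_norm q theta A u k
                           /\ `|(u k a x).2| <= dispz_norm q theta A u k}.
Proof.
move=> q0 uA inc per [_ bounded]; apply: (ae_periodic (unitmx_moire q0 uA inc)).
  by move=> x t Lt; rewrite per.
(* Finiteness ensures that [fine] in [dispz_norm] does not turn an infinite norm into 0. *)
have boundedz : (Linfty_norm (cell (moire_mx q theta A))
    (fun x => `|(u k a x).2|%R) < +oo)%E.
  apply: le_lt_trans (Linfty_norm_le _ _) bounded => x.
  by rewrite normr_id [leRHS]ger0_norm ?enorm_ge0 // ler_enorm3.
have := Linfty_norm_ae boundedz; have := Linfty_norm_ae bounded.
apply: filterS2 => x bx bzx cx; split.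
  apply: le_trans (le_bigmax _ _ a).
  by apply: le_trans (bx cx); exact: ler_norm.
apply: le_trans (le_bigmax _ _ a).
by apply: le_trans (bzx cx); exact: ler_norm.
Qed.

Theorem lemma4p5 (R : realType) (q theta : R) (A : 'M[R]_2)
    (q_gt0 : 0 < q) (A_unit : A \in unitmx)
    (incomm : incommensurate q theta A)
    (sites : layer -> finType) (tau : forall k, sites k -> R2 R)
    (u : forall k, sites k -> R2 R -> R3 R)
    (u_per : moire_periodic q theta A u)
    (r : R) (r_gt1 : 1 < r) (j : layer) (alpha : forall k, sites k)
    (gamma : R2 R)
    (gammaP : cell (layer_mx q theta A (other j)) gamma)
    (u_Linfty : forall k (a : sites k), Linfty (cell (moire_mx q theta A)) (u k a))
    (f : R3 R -> R[i])
    (f_Linfty : Linfty_weighted (2 * r) (slab q theta A tau u) f) :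
  (\int[lebesgue2]_(x in [set: R2 R])
      (cabs (f (flat x + interlayer_shift q theta A tau u j alpha gamma x)))%:E
   <= (5 `^ (r - 1) * pi / (r - 1)
       * (1 + shift_diam tau + disp_norm q theta A u L1
            + disp_norm q theta A u L2) `^ (2 * r))%:E
      * weighted_norm (2 * r) (slab q theta A tau u) f)%E.
Proof.
set g := interlayer_shift q theta A tau u j alpha gamma.
set C := shift_diam tau + disp_norm q theta A u L1 + disp_norm q theta A u L2.
set H := height q theta A tau u.
have d0 : 0 <= shift_diam tau by exact: bigmax_ge_id.
have n0 k : 0 <= disp_norm q theta A u k by exact: bigmax_ge_id.
have nz0 k : 0 <= dispz_norm q theta A u k by exact: bigmax_ge_id.
have C0 : 0 <= C by rewrite !addr_ge0.
have H0 : 0 <= H by rewrite !addr_ge0.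
have g_ae : {ae lebesgue2, forall y, enorm (g y) <= C /\ `|(g y).2| <= H}.
  have := ae_displacement_le q_gt0 A_unit incomm u_per
    (u_Linfty (other j) (alpha (other j))).
  have := ae_displacement_le q_gt0 A_unit incomm u_per (u_Linfty j (alpha j)).
  set D' := invmx (disregistry_mx q theta A j).
  move=> /(negligible_preimage_affine (mulv D' gamma)
    (_ : D' \in unitmx)) nj.
  move=> /(negligible_preimage_affine (mulv D' gamma)
    (unitmx_disregistry_invB1 j q_gt0 A_unit incomm)) no.
  have uD' : D' \in unitmx by rewrite unitmx_inv unitmx_disregistry.
  have {}nj := nj uD'.
  apply: (negligibleS _ (negligibleU nj no)) => y /=.
  rewrite -not_andP; apply: contra_not => -[].
  (* The two affine images become the arguments [D' (y + gamma)] and [D' (y + gamma) - y] of the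
     displacements. *)
  rewrite mulvBl mul1v -mulvD addrAC -mulvD.
  move=> [bj bzj] [bo bzo].
  rewrite /g /interlayer_shift -/D'; split.
    apply: le_trans (ler_enormD _ _) _; rewrite enormN.
    apply: (@le_trans _ _ (shift_diam tau + disp_norm q theta A u j
                           + disp_norm q theta A u (other j))).
      apply: lerD => //; apply: le_trans (ler_enormD _ _) _.
      by apply: lerD => //; exact: shift_diam_ge.
    by rewrite /C; case: (j) => //=; rewrite addrAC.
  (* The shift vectors are horizontal, so only the two vertical displacements remain. *)
  rewrite /= subrr add0r.
  apply: le_trans (ler_normB _ _) _.
  apply: le_trans (lerD bzj bzo) _.
  rewrite /H /height -addrA ler_wpDl //.
  by case: (j) => //=; rewrite addrC.
have [_ _ _ Woo] := f_Linfty.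
set W := weighted_norm _ _ _ in Woo *.
have slab_le p : slab q theta A tau u p ->
    ((japanese p `^ (2 * r) * cabs (f p))%:E <= W)%E.
  by move=> sp; apply: ereal_sup_ubound; exists p.
have cabs_ge0 z : 0 <= cabs z :> R by case: z => a b; exact: sqrtr_ge0.
have W0 : (0 <= W)%E.
  (* The origin lies in the slab since [H >= 0], so the supremum is over a nonempty set. *)
  apply: le_trans (slab_le (0, 0, 0) _).
    by rewrite lee_fin mulr_ge0 ?powR_ge0.
  by split => //=; rewrite in_itv /= oppr_le0 H0.
have WE : W = (fine W)%:E by rewrite fineK // ge0_fin_numE.
have w0 : 0 <= fine W by exact: fine_ge0.
pose K := fine W * (1 + C) `^ (2 * r).
have K0 : 0 <= K by rewrite mulr_ge0 ?powR_ge0.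
apply: (@le_trans _ _ (\int[lebesgue2]_x
    (K%:E * ((1 + x.1 ^+ 2 + x.2 ^+ 2) `^ (- r))%:E))%E).
  apply: ae_le_integral.
  - by move=> x; rewrite lee_fin.
  - by move=> x; rewrite -EFinM lee_fin mulr_ge0 ?powR_ge0.
  - by apply: measurable_funeM; exact: measurable_japanese2.
  apply: filterS g_ae => x [gC gH].
  set p := flat x + g x.
  (* The vertical bound puts [p] in the slab, where the weighted bound holds at every point. *)
  have : ((japanese p `^ (2 * r) * cabs (f p))%:E <= W)%E.
    by apply: slab_le; split => //=; rewrite in_itv /= add0r -ler_norml.
  rewrite WE lee_fin => fp.
  rewrite -EFinM lee_fin.
  have s0 : 0 < 1 + x.1 ^+ 2 + x.2 ^+ 2 by rewrite !ltr_pwDl ?sqr_ge0.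
  rewrite powRN ler_pdivlMr ?powR_gt0 //.
  have jp0 : 0 <= japanese p by exact: sqrtr_ge0.
  have : (1 + x.1 ^+ 2 + x.2 ^+ 2) `^ r
      <= (1 + C) `^ (2 * r) * japanese p `^ (2 * r).
    have c1 : 0 <= 1 + C by rewrite addr_ge0.
    rewrite !powRrM !powR_mulrn // -powRM ?sqr_ge0 //.
    apply: ge0_ler_powR; rewrite ?nnegrE ?mulr_ge0 ?sqr_ge0 ?(ltW s0) //.
      by rewrite ltW // (lt_trans ltr01).
    exact: japanese_shift_le.
  move=> /(ler_wpM2l (cabs_ge0 (f p))) /le_trans; apply.
  rewrite mulrCA /K [leRHS]mulrC ler_wpM2l ?powR_ge0 // mulrC.
  exact: fp.
rewrite ge0_integralZl //; last 2 first.
- exact: measurable_japanese2.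
- by move=> x _; rewrite lee_fin powR_ge0.
apply: (@le_trans _ _ (K%:E * (5 `^ (r - 1) * pi / (r - 1))%:E)%E).
  rewrite lee_wpmul2l ?lee_fin //.
  (* The stated constant follows from [4 <= 5] and [r - 1 > 0]. *)
  apply: (@le_trans _ _ (4 `^ (r - 1) * pi / (r - 1))%:E).
    exact: integral_japanese2_le.
  have e0 : 0 < r - 1 by rewrite subr_gt0.
  rewrite lee_fin !ler_wpM2r ?invr_ge0 ?pi_ge0 ?(ltW e0) //.
  by apply: ge0_ler_powR; rewrite ?nnegrE ?(ltW e0) ?ler_nat.
rewrite [in leRHS]WE -!EFinM lee_fin /K -/C !addrA.
by rewrite le_eqVlt; apply/orP; left; apply/eqP; ring.
Qed.
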